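(* Let $k\ge 1$, let $p_1,\dots,p_k$ be distinct primes, let $m_1,\dots,m_k\ge 2$ be integers with $p_i\nmid m_i$ for $i=1,\dots,k$, and let $a_1,\dots,a_k$ be integers with $0\le a_i\le m_i-1$. Put $m:=\max\{m_i: 1\le i\le k\}$, $p:=\max\{p_i:1\le i\le k\}$ and $\delta:=1/(120k^2p^{3m}m^2)$. Then, as $N\to\infty$, $$\bigl|\{0\le n<N:\ e_{p_i}(n)\equiv a_i \pmod{m_i}\ \text{for all } 1\le i\le k\}\bigr| = \frac{N}{m_1\cdots m_k}+O(N^{1-\delta}),$$ where the implied constant depends only on $p_1,\dots,p_k$ and $m_1,\dots,m_k$ (and not on $a_1,\dots,a_k$ or $N$). In particular, for any distinct odd primes $p_1,\dots,p_k$ and any $\varepsilon_1,\dots,\varepsilon_k\in\{0,1\}$, the number of $0\le n<N$ with $e_{p_i}(n)\equiv\varepsilon_i\pmod 2$ for all $i$ is asymptotic to $N/2^k$.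
   Context: For a prime $p$ and a non-negative integer $n$, $e_p(n)$ denotes the exponent of $p$ in the prime factorization of $n!$ (with $e_p(0)=0$). *)

(* Defs.v *)
From mathcomp Require Import all_boot.
From Stdlib Require Import Reals.

Set Implicit Arguments.
Unset Strict Implicit.
Unset Printing Implicit Defensive.

Definition e_fact (p n : nat) : nat := logn p n`!.

Definition count_good (k : nat) (p m a : 'I_k -> nat) (N : nat) : nat :=
  count (fun n => [forall i : 'I_k, e_fact (p i) n == a i %[mod m i]]) (iota 0 N).

Definition max_m (k : nat) (m : 'I_k -> nat) : nat := \max_(i < k) m i.
Definition max_p (k : nat) (p : 'I_k -> nat) : nat := \max_(i < k) p i.

Definition delta (k : nat) (p m : 'I_k -> nat) : R :=
  (1 / INR (120 * k ^ 2 * (max_p p) ^ (3 * max_m m) * (max_m m) ^ 2))%R.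

(* Main.v *)
(** Fourier analysis over [algC].  By orthogonality it suffices to bound
    [S = sum_(n < N) prod_i w_i ^ e_(p_i)(n)] for roots of unity [w_i], one of
    which, [w_j], is not [1].

    Since [e_p(p u + d) = u + e_p(u)] for [d < p], the exponential sum
    [E_s(x) = sum_(h < p^s) w^(e_p(h)) x^h] satisfies
    [E_(s+1)(x) = (1 + x + ... + x^(p-1)) E_s(w x^p)].  The points [x] and
    [w x^p] cannot both be close to [1] when [w <> 1], so two consecutive
    digits save a constant factor, uniformly in [x] on the unit circle.

    Cut [0, N) into blocks [u H + h], [h < H = p_j^(2t)].  Unless adding [h]
    to [u H] causes a carry beyond the digit [r_i] in some base [p_i], [i <> j],
    the other factors agree on a block, up to a unimodular constant, with a
    function of period [M = prod_(i <> j) p_i^(r_i)].  As [u] runs over a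
    period, so does [u H] modulo [M], and Parseval on Z/M bounds the mean of
    the block sums by the supremum of [E_(2t)].  With [z] about [N^(1/2k)],
    one takes [H <= z] and [p_i^(r_i)] just above [z^2]. *)
Require Import Defs.
From mathcomp Require Import all_boot all_order all_algebra all_field ring.

Set Implicit Arguments.
Unset Strict Implicit.
Unset Printing Implicit Defensive.

(** * Legendre's formula, one digit at a time *)

(** Since floor((p u + d) / p^(i+1)) = floor(u / p^i), the first term of Legendre's sum for p u + d
    is u and the remaining terms form the sum for u. *)
Lemma e_factS p u d : prime p -> d < p -> e_fact p (p * u + d) = u + e_fact p u.
Proof.
move=> p_pr ltdp; have p_gt0 := prime_gt0 p_pr; have p_gt1 := prime_gt1 p_pr.
rewrite /e_fact !logn_fact //.
have divp n : n = p * u + d -> n %/ p = u.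
  by move=> ->; rewrite mulnC divnMDl // divn_small // addn0.
case: u divp => [|u] divp.
  rewrite muln0 add0n !big_nat [RHS]big1 ?add0n => [|i _]; last by rewrite div0n.
  rewrite big1 // => i /andP[i_gt0 _]; rewrite divn_small //.
  by apply: leq_trans ltdp _; rewrite -[leqLHS]expn1 leq_exp2l.
set n := p * u.+1 + d.
have ltun : u.+1 < n.
  by rewrite /n; apply: leq_trans (leq_addr _ _); rewrite ltn_Pmull.
have n_gt0 : 0 < n by apply: leq_ltn_trans ltun.
rewrite big_ltn // expn1 divp //; congr (_ + _).
(* After the shift of index the range is longer than that of the sum for [u.+1]; the extra terms
   have p^i > i > u + 1 and vanish. *)
rewrite big_add1 /= (big_cat_nat (n := u.+2)) //= [X in _ + X]big_nat [X in _ + X]big1 ?addn0.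
  by apply: eq_bigr => i _; rewrite expnS divnMA divp.
move=> i /andP[lti _]; rewrite expnS divnMA divp // divn_small //.
by apply: leq_trans lti _; apply: ltnW; rewrite ltn_expl.
Qed.

(** The addition is carry-free, and e_p is additive on carry-free sums. The induction strips the
    last digit of h with [e_factS]. *)
Lemma e_fact_split p r u h : prime p -> h < p ^ r ->
  e_fact p (p ^ r * u + h) = e_fact p (p ^ r * u) + e_fact p h.
Proof.
move=> p_pr; have p_gt0 := prime_gt0 p_pr.
elim: r u h => [|r IHr] u h; first rewrite expn0 ltnS leqn0 => /eqP->.
  by rewrite /e_fact logn1 !addn0.
rewrite expnS => lth.
have hE := divn_eq h p; have ltd := ltn_pmod h p_gt0.
have lth' : h %/ p < p ^ r by rewrite ltn_divLR // mulnC.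
have eh : e_fact p h = h %/ p + e_fact p (h %/ p) by rewrite {1}hE mulnC e_factS.
have eu : e_fact p (p * p ^ r * u) = p ^ r * u + e_fact p (p ^ r * u).
  by rewrite -mulnA -[p * (p ^ r * u)]addn0 e_factS.
have -> : p * p ^ r * u + h = p * (p ^ r * u + h %/ p) + h %% p.
  by rewrite {1}hE mulnDr mulnA [_ %/ p * p]mulnC addnA.
by rewrite e_factS // IHr // eh eu addnACA.
Qed.

Import Order.TTheory GRing.Theory Num.Theory.
Local Open Scope ring_scope.

(** * Sums of periodic functions *)

Section PeriodicSums.
Variable V : nmodType.
Implicit Type f : nat -> V.

Lemma sum_block f U H :
  \sum_(n < U * H) f n = \sum_(u < U) \sum_(h < H) f (u * H + h)%N.
Proof.
elim: U => [|U IHU]; first by rewrite !big_ord0.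
rewrite big_ord_recr /= -IHU mulSn addnC big_split_ord /=.
by congr (_ + _); apply: eq_bigr.
Qed.

Lemma sum_shift f M h : (forall n, f (n + M)%N = f n) ->
  \sum_(v < M) f (v + h)%N = \sum_(v < M) f v.
Proof.
move=> fM; elim: h => [|h <-].
  by apply: eq_bigr => v _; rewrite addn0.
case: M fM => [|M] fM; first by rewrite !big_ord0.
rewrite big_ord_recr [RHS]big_ord_recl addrC /= add0n addnS -addSn addnC fM.
by congr (_ + _); apply: eq_bigr => v _; rewrite addnS.
Qed.

Lemma periodic_modn f M n : (forall n, f (n + M)%N = f n) -> f (n %% M)%N = f n.
Proof.
move=> fM; rewrite {2}(divn_eq n M) addnC.
elim: (n %/ M)%N => [|q IHq]; first by rewrite addn0.
by rewrite mulSn [(M + _)%N]addnC addnA fM.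
Qed.

(** Multiplication by H permutes the residues modulo M. *)
Lemma sum_dilate f M H : (forall n, f (n + M)%N = f n) -> coprime H M ->
  \sum_(u < M) f (u * H)%N = \sum_(v < M) f v.
Proof.
case: M => [|M] fM coHM; first by rewrite !big_ord0.
pose s (u : 'I_M.+1) : 'I_M.+1 := inord (u * H %% M.+1).
have sE u : s u = (u * H %% M.+1)%N :> nat by rewrite inordK // ltn_pmod.
rewrite [RHS](reindex_inj (h := s)) => [|u v /(congr1 val)].
  by apply: eq_bigr => u _; rewrite sE periodic_modn.
rewrite /= !sE => eq_uv.
wlog leuv : u v eq_uv / (u <= v)%N => [IH|].
  by case/orP: (leq_total u v) => [|levu]; [apply: IH | apply/esym; apply: IH].
move/esym/eqP: eq_uv; rewrite eqn_mod_dvd ?leq_mul2r ?leuv ?orbT //.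
rewrite -mulnBl Gauss_dvdl 1?coprime_sym // => dvdM.
apply: val_inj; apply/eqP; rewrite eqn_leq leuv /= -subn_eq0.
by move: dvdM; apply: contraLR => vu; rewrite gtnNdvd ?lt0n // (leq_ltn_trans (leq_subr _ _)).
Qed.

End PeriodicSums.

(** Nonnegativity allows the range to be extended to a whole number of periods. *)
Lemma sum_periodic_le (f : nat -> algC) U M : (0 < M)%N ->
  (forall n, f (n + M)%N = f n) -> (forall n, 0 <= f n) ->
  \sum_(u < U) f u <= (U %/ M).+1%:R * \sum_(u < M) f u.
Proof.
move=> M_gt0 fM f_ge0.
have -> : (U %/ M).+1%:R * \sum_(u < M) f u = \sum_(u < (U %/ M).+1 * M) f u.
  rewrite sum_block mulr_natl -[X in _ *+ X]card_ord -sumr_const.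
  apply: eq_bigr => q _; rewrite -[LHS](sum_shift (q * M) fM).
  by apply: eq_bigr => v _; rewrite addnC.
have leU : (U <= (U %/ M).+1 * M)%N by rewrite ltnW // -ltn_divLR.
rewrite (big_ord_widen _ _ leU) [leRHS](bigID (fun u : 'I__ => (u < U)%N)) /=.
by rewrite lerDl sumr_ge0.
Qed.

(** * Fourier analysis on Z/M *)

Lemma norm_unity (w : algC) n : (0 < n)%N -> w ^+ n = 1 -> `|w| = 1.
Proof.
by move=> n_gt0 wn; apply/eqP; rewrite -(@pexpr_eq1 _ _ n) -?normrX ?wn ?normr1.
Qed.

(** Once the squares are expanded, the product of f(v) and the conjugate of f(v') carries the sum of
    the M first powers of w^(v - v'), which is M on the diagonal and 0 elsewhere. *)
Lemma parseval (f : nat -> algC) M w : M.-primitive_root w ->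
  \sum_(x < M) `|\sum_(v < M) f v * w ^+ (x * v)| ^+ 2
    = M%:R * \sum_(v < M) `|f v| ^+ 2.
Proof.
move=> prim_w; have M_gt0 := prim_order_gt0 prim_w.
have w1 : `|w| = 1 by apply: norm_unity M_gt0 (prim_expr_order prim_w).
have ww n : w ^+ n * (w ^+ n)^* = 1 by rewrite -normCK normrX w1 !expr1n.
under eq_bigr => x _ do rewrite normCK rmorph_sum big_distrlr /=.
rewrite exchange_big mulr_sumr /=; apply: eq_bigr => v _.
rewrite exchange_big (bigD1 v) //= [X in _ + X]big1 ?addr0 => [|v' nev].
  rewrite mulr_natl -[X in _ *+ X]card_ord -sumr_const; apply: eq_bigr => x _.
  by rewrite rmorphM mulrACA ww mulr1 -normCK.
(* This is w^(v - v'), as conjugation inverts on the unit circle. *)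
pose u := w ^+ v * (w ^+ v')^*.
transitivity (f v * (f v')^* * \sum_(x < M) u ^+ x).
  rewrite mulr_sumr; apply: eq_bigr => x _.
  by rewrite rmorphM mulrACA exprMn -rmorphXn -!exprM ![(x * _)%N]mulnC.
have uM : u ^+ M = 1.
  rewrite exprMn -rmorphXn -!exprM !(mulnC _ M) !exprM (prim_expr_order prim_w).
  by rewrite !expr1n rmorph1 mulr1.
have u_neq1 : u - 1 != 0.
  rewrite subr_eq0; apply: contra nev => /eqP u1.
  have /eqP : w ^+ v = w ^+ v'.
    by rewrite -[LHS]mulr1 -(ww v') [w ^+ v' * _]mulrC mulrA -/u u1 mul1r.
  by rewrite (eq_prim_root_expr prim_w) eqE /= !modn_small // eq_sym.
move: (subrX1 u M); rewrite uM subrr => /esym/eqP.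
by rewrite mulf_eq0 (negPf u_neq1) => /eqP->; rewrite mulr0.
Qed.

(* By Parseval on Z/M, correlating with F multiplies the Fourier coefficients
   of F by values of the trigonometric polynomial of a. *)
Lemma sum_norm_convolution_le (a F : nat -> algC) H M (B : algC) : (0 < M)%N -> 0 < B ->
  (forall n, F (n + M)%N = F n) -> (forall n, `|F n| = 1) ->
  (forall x : algC, `|x| = 1 -> `|\sum_(h < H) a h * x ^+ h| <= B) ->
  \sum_(v < M) `|\sum_(h < H) a h * F (v + h)%N| <= M%:R * B.
Proof.
move=> M_gt0 B_gt0 FM F1 supB.
have [w prim_w] := C_prim_root_exists M_gt0.
have w1 : `|w| = 1 by apply: norm_unity M_gt0 (prim_expr_order prim_w).
have w_neq0 : w != 0 by rewrite -normr_eq0 w1 oner_eq0.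
pose A v := \sum_(h < H) a h * F (v + h)%N.
pose Fhat x := \sum_(v < M) F v * w ^+ (x * v).
have Ahat (x : nat) : \sum_(v < M) A v * w ^+ (x * v)
    = (\sum_(h < H) a h * (w ^- x) ^+ h) * Fhat x.
  transitivity (\sum_(h < H) a h * w ^- (x * h)
      * \sum_(v < M) (F (v + h)%N * w ^+ (x * (v + h)))).
    under eq_bigr => v _ do rewrite mulr_suml.
    rewrite exchange_big; apply: eq_bigr => h _; rewrite mulr_sumr.
    apply: eq_bigr => v _; rewrite mulnDr exprD; field.
    by rewrite expf_neq0.
  rewrite mulr_suml; apply: eq_bigr => h _; rewrite exprVn -exprM.
  congr (_ * _); rewrite (sum_shift (f := fun n => F n * w ^+ (x * n))) // => n.
  by rewrite FM mulnDr exprD [w ^+ (x * M)]exprM exprAC (prim_expr_order prim_w) expr1n mulr1.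
have sumA2 : \sum_(v < M) `|A v| ^+ 2 <= M%:R * B ^+ 2.
  have MR_gt0 : 0 < M%:R :> algC by rewrite ltr0n.
  rewrite -(ler_pM2l MR_gt0) -(parseval _ prim_w).
  apply: (@le_trans _ _ (\sum_(x < M) B ^+ 2 * `|Fhat x| ^+ 2)).
    apply: ler_sum => x _; rewrite Ahat normrM exprMn ler_wpM2r ?exprn_ge0 //.
    rewrite lerXn2r ?nnegrE ?(ltW B_gt0) //; apply: supB.
    by rewrite normfV normrX w1 expr1n invr1.
  rewrite -mulr_sumr (parseval _ prim_w).
  under eq_bigr => v _ do rewrite F1 expr1n.
  by rewrite sumr_const card_ord mulrCA [B ^+ 2 * _]mulrC.
(* From second to first moment: 2 B |A| <= |A|^2 + B^2 takes the place of Cauchy-Schwarz and avoids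
   square roots. *)
rewrite -(ler_pM2l (_ : 0 < B *+ 2)) ?pmulrn_rgt0 // mulr_sumr.
apply: (@le_trans _ _ (\sum_(v < M) (`|A v| ^+ 2 + B ^+ 2))).
  apply: ler_sum => v _; rewrite -subr_ge0.
  have -> : `|A v| ^+ 2 + B ^+ 2 - B *+ 2 * `|A v| = (`|A v| - B) ^+ 2 by ring.
  by rewrite real_exprn_even_ge0 // rpredB ?normr_real // gtr0_real.
rewrite big_split /= sumr_const card_ord.
apply: le_trans (lerD sumA2 (lexx _)) _.
by have -> : M%:R * B ^+ 2 + B ^+ 2 *+ M = B *+ 2 * (M%:R * B) by ring.
Qed.

(** * Distance to 1 on the unit circle *)

Lemma dist1_expr_le (x : algC) n : `|x| = 1 -> `|1 - x ^+ n| <= n%:R * `|1 - x|.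
Proof.
move=> x1; elim: n => [|n IHn]; first by rewrite expr0 subrr normr0 mul0r.
have -> : 1 - x ^+ n.+1 = (1 - x) + x * (1 - x ^+ n) by rewrite exprS; ring.
apply: le_trans (ler_normD _ _) _.
by rewrite normrM x1 mul1r -natr1 mulrDl mul1r addrC lerD2r.
Qed.

(** The powers of w sum to 0, so m is the sum of the 1 - w^i over i < m, each of modulus at most m
    |1 - w|. *)
Lemma dist1_unity_root_ge (w : algC) m : (0 < m)%N -> w ^+ m = 1 -> w != 1 ->
  1 <= m%:R * `|1 - w|.
Proof.
move=> m_gt0 wm w_neq1; have w1 := norm_unity m_gt0 wm.
have mR : 0 < m%:R :> algC by rewrite ltr0n.
have sum0 : \sum_(i < m) w ^+ i = 0.
  move: (subrX1 w m); rewrite wm subrr => /esym/eqP.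
  by rewrite mulf_eq0 subr_eq0 (negPf w_neq1) => /eqP.
rewrite -(ler_pM2l mR) mulr1.
have {1}-> : m%:R = `|\sum_(i < m) (1 - w ^+ i)| :> algC.
  by rewrite sumrB sum0 subr0 sumr_const card_ord normr_nat.
apply: le_trans (ler_norm_sum _ _ _) _.
rewrite [leRHS]mulr_natl -[X in _ *+ X]card_ord -sumr_const.
apply: ler_sum => i _; apply: le_trans (dist1_expr_le _ w1) _.
by rewrite ler_wpM2r // ler_nat ltnW.
Qed.

(** The first two terms alone give the saving: with a = |1 - x|, the parallelogram law yields |1 +
    x|^2 = 4 - a^2 <= (2 - a^2/4)^2. The other p - 2 terms are bounded by 1 each. *)
Lemma norm_geom_sum_le (x : algC) p : (1 < p)%N -> `|x| = 1 ->
  `|\sum_(d < p) x ^+ d| <= p%:R - `|1 - x| ^+ 2 / 4%:R.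
Proof.
case: p => [|[|p]] // _ x1.
have x0 : x * x^* = 1 by rewrite -normCK x1 expr1n.
pose a := `|1 - x|; have a_ge0 : 0 <= a := normr_ge0 _.
have a_le2 : a <= 2%:R.
  by apply: le_trans (ler_normB _ _) _; rewrite normr1 x1.
have sq : `|1 + x| ^+ 2 = 4%:R - a ^+ 2.
  rewrite /a !normCK !(rmorphB, rmorphD, rmorph1) /=.
  have -> : (1 + x) * (1 + x^*) = 1 + x + x^* + x * x^* by ring.
  have -> : (1 - x) * (1 - x^*) = 1 - x - x^* + x * x^* by ring.
  by rewrite x0; ring.
have b_ge0 : 0 <= 2%:R - a ^+ 2 / 4%:R.
  rewrite subr_ge0 ler_pdivrMr ?ltr0n // -natrM.
  apply: (@le_trans _ _ (2%:R ^+ 2)); first by rewrite lerXn2r ?nnegrE ?ler0n.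
  by rewrite -natrX ler_nat.
have le1 : `|1 + x| <= 2%:R - a ^+ 2 / 4%:R.
  rewrite -(@ler_pXn2r _ 2) ?nnegrE // sq -subr_ge0.
  have -> : (2%:R - a ^+ 2 / 4%:R) ^+ 2 - (4%:R - a ^+ 2) = (a ^+ 2 / 4%:R) ^+ 2 by field.
  by rewrite !(exprn_ge0, divr_ge0) ?ler0n.
rewrite 2!big_ord_recl /= expr0 expr1 addrA.
apply: le_trans (ler_normD _ _) _.
have -> : p.+2%:R - a ^+ 2 / 4%:R = 2%:R - a ^+ 2 / 4%:R + p%:R :> algC.
  by rewrite -[p.+2]addn2 natrD; ring.
rewrite lerD //; apply: le_trans (ler_norm_sum _ _ _) _.
rewrite -[X in _ <= X%:R]card_ord -sumr_const; apply: ler_sum => i _.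
by rewrite normrX x1 expr1n.
Qed.

Lemma norm_sum_le_card (f : nat -> algC) n : (forall i, `|f i| = 1) ->
  `|\sum_(i < n) f i| <= n%:R.
Proof.
move=> f1; apply: le_trans (ler_norm_sum _ _ _) _.
by rewrite -[X in _ <= X%:R]card_ord -sumr_const ler_sum // => i _; rewrite f1.
Qed.

(** * Exponential sums over the digits in one base *)

Section DigitSums.

Variables (p m : nat) (w : algC) (lam : algC).
Hypotheses (p_pr : prime p) (m_gt0 : (0 < m)%N) (wm : w ^+ m = 1) (w_neq1 : w != 1).
Hypotheses (lam_ge0 : 0 <= lam) (lam_ge : 1 - (4 * p * (p.+1 * m) ^ 2)%:R^-1 <= lam).

Let w1 : `|w| = 1 := norm_unity m_gt0 wm.
Let p_gt1 := prime_gt1 p_pr.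

Lemma sum_digit (s : nat) (x : algC) :
  \sum_(h < p ^ s.+1) w ^+ e_fact p h * x ^+ h
  = (\sum_(d < p) x ^+ d) * \sum_(u < p ^ s) w ^+ e_fact p u * (w * x ^+ p) ^+ u.
Proof.
rewrite expnSr (sum_block (fun h => w ^+ e_fact p h * x ^+ h)) mulr_sumr.
apply: eq_bigr => u _; rewrite mulr_suml; apply: eq_bigr => d _.
by rewrite mulnC e_factS // exprMn !exprD [x ^+ (p * u)]exprM; ring.
Qed.

(* If both x and w x^p were close to 1, then so would be w = (w x^p) x^-p. *)
Lemma far_from_1 (x : algC) : `|x| = 1 ->
  1 <= (p.+1 * m)%:R * `|1 - x| \/ 1 <= (p.+1 * m)%:R * `|1 - w * x ^+ p|.
Proof.
move=> x1; have c_gt0 : 0 < (p.+1 * m)%:R :> algC by rewrite ltr0n muln_gt0.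
have re (y : algC) : (p.+1 * m)%:R * `|y| \is Num.real.
  by rewrite rpredM ?normr_real ?realn.
have [?|lt1] := real_leP (@real1 _) (re (1 - x)); first by left.
have [?|lt2] := real_leP (@real1 _) (re (1 - w * x ^+ p)); first by right.
have := dist1_unity_root_ge m_gt0 wm w_neq1.
have : (p.+1%:R : algC) * (m%:R * `|1 - w|) < p.+1%:R.
  have tri : `|1 - w| <= `|1 - w * x ^+ p| + p%:R * `|1 - x|.
    have -> : 1 - w = (1 - w * x ^+ p) - w * (1 - x ^+ p) by ring.
    apply: le_trans (ler_normB _ _) _; rewrite lerD2l normrM w1 mul1r.
    exact: dist1_expr_le.
  rewrite mulrA -natrM.
  apply: le_lt_trans (ler_wpM2l (ltW c_gt0) tri) _.
  rewrite mulrDr -nat1r; apply: ltr_leD => //.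
  rewrite mulrCA -[leRHS]mulr1 ler_wpM2l ?ler0n //; exact: ltW.
rewrite -[ltRHS]mulr1 ltr_pM2l ?ltr0n // => /lt_le_trans lt /lt.
by rewrite ltxx.
Qed.

(** The saving |1 - x|^2 / 4 is at least 1 / (4 ((p+1) m)^2), and its ratio to p is the constant in
    [lam_ge]. Keeping [lam] free above this threshold lets one value serve all the primes and moduli
    later. *)
Lemma norm_geom_sum_far (x : algC) : `|x| = 1 -> 1 <= (p.+1 * m)%:R * `|1 - x| ->
  `|\sum_(d < p) x ^+ d| <= p%:R * lam.
Proof.
move=> x1 far; apply: le_trans (norm_geom_sum_le p_gt1 x1) _.
have p0 : 0 < p%:R :> algC by rewrite ltr0n ltnW.
have c_gt0 : 0 < (p.+1 * m)%:R :> algC by rewrite ltr0n muln_gt0.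
apply: (@le_trans _ _ (p%:R * (1 - (4 * p * (p.+1 * m) ^ 2)%:R^-1))); last first.
  by rewrite ler_wpM2l // ltW.
rewrite mulrBr mulr1 lerD2l lerN2.
have -> : p%:R / (4 * p * (p.+1 * m) ^ 2)%:R = (p.+1 * m)%:R ^-2 / 4%:R :> algC.
  by rewrite !natrM; field; rewrite nat1r !pnatr_eq0 -!lt0n m_gt0 (ltnW p_gt1).
rewrite ler_wpM2r ?invr_ge0 ?ler0n // -[leLHS]mulr1.
apply: le_trans (ler_wpM2l _ (exprn_ege1 2 far)) _; first by rewrite invr_ge0 exprn_ge0 // ltW.
by rewrite exprMn mulKf // expf_neq0 // lt0r_neq0.
Qed.

Lemma norm_sum_digits_le t (x : algC) : `|x| = 1 ->
  `|\sum_(h < p ^ t.*2) w ^+ e_fact p h * x ^+ h| <= (p ^ t.*2)%:R * lam ^+ t.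
Proof.
elim: t x => [|t IHt] x x1.
  by rewrite big_ord1 !expr0 /e_fact logn1 expr0 mulr1 normr1.
have y1 : `|w * x ^+ p| = 1 by rewrite normrM normrX x1 w1 expr1n mulr1.
have y2 : `|w * (w * x ^+ p) ^+ p| = 1 by rewrite normrM normrX y1 w1 expr1n mulr1.
rewrite doubleS !sum_digit mulrA normrM.
have -> : (p ^ t.*2.+2)%:R * lam ^+ t.+1 = p%:R * (p%:R * lam) * ((p ^ t.*2)%:R * lam ^+ t).
  by rewrite !expnS !natrM exprS; ring.
apply: ler_pM => //; last exact: IHt.
have triv (y : algC) : `|y| = 1 -> `|\sum_(d < p) y ^+ d| <= p%:R.
  by move=> yE; apply: norm_sum_le_card => d; rewrite normrX yE expr1n.
(* The two digits contribute geometric sums at x and at w x^p; one of them saves [lam] and the other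
   is bounded by p. *)
rewrite normrM; case: (far_from_1 x1) => far.
  by rewrite mulrC ler_pM ?triv //; apply: norm_geom_sum_far.
by rewrite ler_pM ?triv //; apply: norm_geom_sum_far.
Qed.

End DigitSums.

(** * Blocks and carries *)

(** The term [H%:R] pays for the incomplete last block. [bad] vanishes on the blocks where G may be
    replaced by F; elsewhere it is at least 1, so H times [bad] covers the trivial bound. *)
Lemma block_sum_le (g G F : nat -> algC) (bad : nat -> nat) (H M N : nat) (B : algC) :
  (0 < H)%N -> (0 < M)%N -> coprime H M -> 0 < B ->
  (forall n, `|g n| = 1) -> (forall n, `|G n| = 1) -> (forall n, `|F n| = 1) ->
  (forall n, F (n + M)%N = F n) -> (forall n, bad (n + M)%N = bad n) ->
  (forall u h, (h < H)%N -> g (u * H + h)%N = g (u * H)%N * g h) ->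
  (forall u, bad (u * H)%N = 0%N -> exists2 c : algC, `|c| = 1 &
     forall h, (h < H)%N -> G (u * H + h)%N = c * F (u * H + h)%N) ->
  (forall x : algC, `|x| = 1 -> `|\sum_(h < H) g h * x ^+ h| <= B) ->
  `|\sum_(n < N) g n * G n| <=
    H%:R + (N %/ H %/ M).+1%:R * (M%:R * B + (H * \sum_(v < M) bad v)%:R).
Proof.
move=> H_gt0 M_gt0 coHM B_gt0 g1 G1 F1 FM badM gH GF supB.
have gG1 n : `|g n * G n| = 1 by rewrite normrM g1 G1 mulr1.
pose A v := \sum_(h < H) g h * F (v + h)%N.
(* An M-periodic majorant of the block sums, valid on good and bad blocks alike; periodicity is what
   allows [sum_dilate] to replace u H by v. *)
pose psi v := `|A v| + (H * bad v)%:R.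
have psi_ge0 v : 0 <= psi v by rewrite addr_ge0 ?ler0n.
have psiM v : psi (v + M)%N = psi v.
  rewrite /psi badM; congr (`|_| + _); apply: eq_bigr => h _.
  by rewrite addnAC FM.
have psiHM u : psi ((u + M) * H)%N = psi (u * H)%N.
  by rewrite mulnDl -(periodic_modn _ psiM) addnC mulnC modnMDl periodic_modn.
have -> : \sum_(n < N) g n * G n = \sum_(n < N %/ H * H + N %% H) g n * G n.
  by rewrite -divn_eq.
rewrite big_split_ord /= addrC.
apply: le_trans (ler_normD _ _) _; apply: lerD.
  pose f i := g (N %/ H * H + i)%N * G (N %/ H * H + i)%N.
  apply: le_trans (norm_sum_le_card (f := f) _ _) _.
    by move=> i; apply: gG1.
  by rewrite ler_nat ltnW // ltn_pmod.
rewrite (sum_block (fun n => g n * G n)).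
apply: le_trans (ler_norm_sum _ _ _) _.
apply: (@le_trans _ _ (\sum_(u < N %/ H) psi (u * H)%N)).
  apply: ler_sum => u _; have [bad0|bad_n0] := eqVneq (bad (u * H)%N) 0%N.
    have [c c1 GE] := GF u bad0.
    rewrite /psi bad0 muln0 addr0.
    have -> : \sum_(h < H) g (u * H + h)%N * G (u * H + h)%N = (g (u * H)%N * c) * A (u * H)%N.
      rewrite mulr_sumr; apply: eq_bigr => h _.
      by rewrite gH ?ltn_ord // GE ?ltn_ord //; ring.
    by rewrite !normrM g1 c1 !mul1r.
  apply: (@le_trans _ _ H%:R).
    exact: (norm_sum_le_card (f := fun h => g (u * H + h)%N * G (u * H + h)%N)).
  have leH : H%:R <= (H * bad (u * H)%N)%:R :> algC by rewrite ler_nat leq_pmulr // lt0n.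
  by apply: le_trans leH _; rewrite lerDr.
apply: le_trans (sum_periodic_le _ M_gt0 psiHM (fun u => psi_ge0 _)) _.
rewrite ler_wpM2l ?ler0n // (sum_dilate psiM coHM) big_split /=.
by rewrite lerD ?sum_norm_convolution_le // big_distrr /= natr_sum.
Qed.

(** Some offset h <= H - 1 carries v past P exactly when P < v + H, that is, for v among the last H
    - 1 residues. *)
Lemma count_carry_le P H : (\sum_(v < P) (P < v + H) <= H)%N.
Proof.
rewrite (reindex_inj rev_ord_inj) /=.
have -> : (\sum_(v < P) (P < P - v.+1 + H) = \sum_(v < P) (v.+1 < H))%N.
  apply: eq_bigr => v _; congr nat_of_bool.
  by rewrite -(ltn_add2r v.+1) addnAC subnK // ltn_add2l.
suff : (\sum_(v < P) (v.+1 < H) <= minn P H)%N.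
  by move/leq_trans; apply; apply: geq_minr.
elim: P => [|P IHP]; first by rewrite big_ord0.
rewrite big_ord_recr /=; case: ltnP => [ltPH|leHP] /=.
  by rewrite addn1 ltnS (leq_trans IHP) ?geq_minl.
by rewrite addn0 (leq_trans IHP) ?geq_minr.
Qed.

Lemma count_carry_periods_le P H M : (P %| M)%N -> (0 < P)%N ->
  (\sum_(v < M) (P < v %% P + H) <= M %/ P * H)%N.
Proof.
move=> /dvdnP[q ->] P_gt0; rewrite mulnK //.
have /= -> := @sum_block nat (fun v => nat_of_bool (P < v %% P + H)%N) q P.
rewrite -[X in (_ <= X * H)%N]card_ord -sum_nat_const; apply: leq_sum => u _.
apply: leq_trans (count_carry_le P H); apply: leq_sum => v _.
by rewrite modnMDl modn_small.
Qed.

Lemma expr_e_fact_split p r u h (w : algC) : prime p -> (h < p ^ r)%N ->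
  w ^+ e_fact p (u * p ^ r + h)%N = w ^+ e_fact p (u * p ^ r)%N * w ^+ e_fact p h.
Proof. by move=> p_pr lth; rewrite mulnC e_fact_split // exprD. Qed.

(** Here [block_sum_le] is applied with the base p_j factor as g and the product of the others as G;
    F reads only the residues of n modulo the p_i^(r_i), and [bad] counts the bases in which a carry
    may occur. *)
Lemma char_sum_le k (p m : 'I_k -> nat) (w : 'I_k -> algC) (r : 'I_k -> nat)
    (j : 'I_k) (t N : nat) (lam : algC) :
  let H := (p j ^ t.*2)%N in
  let M := (\prod_(i < k | i != j) p i ^ r i)%N in
  injective p -> (forall i, prime (p i)) -> (forall i, 0 < m i)%N ->
  (forall i, w i ^+ m i = 1) -> w j != 1 -> 0 < lam ->
  1 - (4 * p j * ((p j).+1 * m j) ^ 2)%:R^-1 <= lam ->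
  `|\sum_(n < N) \prod_i w i ^+ e_fact (p i) n| <=
    H%:R + (N %/ H %/ M).+1%:R *
      (M%:R * (H%:R * lam ^+ t) + (H * \sum_(i < k | i != j) M %/ p i ^ r i * H)%:R).
Proof.
move=> H M p_inj p_pr m_gt0 wm wj lam_gt0 lam_ge.
have w1 i : `|w i| = 1 := norm_unity (m_gt0 i) (wm i).
have pr_gt0 i n : (0 < p i ^ n)%N by rewrite expn_gt0 prime_gt0.
have H_gt0 : (0 < H)%N := pr_gt0 _ _.
have M_gt0 : (0 < M)%N by apply: prodn_cond_gt0.
have dvdM i : i != j -> (p i ^ r i %| M)%N.
  by move=> nei; rewrite /M (bigD1 i) //= dvdn_mulr.
have coHM : coprime H M.
  rewrite /M; elim/big_rec: _ => [|i x nei cox]; first exact: coprimen1.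
  rewrite coprimeMr cox andbT coprimeXl // coprimeXr //.
  rewrite prime_coprime // dvdn_prime2 //.
  by apply: contra nei => /eqP/p_inj->.
pose g n := w j ^+ e_fact (p j) n.
pose G n := \prod_(i < k | i != j) w i ^+ e_fact (p i) n.
pose F n := \prod_(i < k | i != j) w i ^+ e_fact (p i) (n %% p i ^ r i).
pose bad v := (\sum_(i < k | i != j) (p i ^ r i < v %% p i ^ r i + H))%N.
have norm_prod (f : 'I_k -> nat) : `|\prod_(i < k | i != j) w i ^+ f i| = 1.
  by rewrite normr_prod big1 // => i _; rewrite normrX w1 expr1n.
have modM i n : i != j -> ((n + M) %% p i ^ r i = n %% p i ^ r i)%N.
  by move=> /dvdM dvd; rewrite -modnDmr (eqP dvd) addn0.
under eq_bigr => n _ do rewrite (bigD1 j) //=.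
have bound := @block_sum_le g G F bad H M N (H%:R * lam ^+ t).
apply: le_trans (bound _ _ _ _ _ _ _ _ _ _ _ _) _ => //.
- by rewrite mulr_gt0 ?exprn_gt0 // ltr0n.
- by move=> n; rewrite normrX w1 expr1n.
- by move=> n; apply: norm_prod.
- by move=> n; apply: norm_prod.
- by move=> n; apply: eq_bigr => i nei; rewrite modM.
- by move=> n; apply: eq_bigr => i nei; rewrite modM.
- by move=> u h lth; rewrite /g expr_e_fact_split.
- move=> u /eqP; rewrite sum_nat_eq0 => /forall_inP bad0.
  (* Without carry the quotient by p_i^(r_i) is constant on the block, so the high digits contribute
     this constant. *)
  exists (\prod_(i < k | i != j) w i ^+ e_fact (p i) ((u * H) %/ p i ^ r i * p i ^ r i)%N).
    exact: norm_prod.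
  move=> h lth; rewrite -big_split; apply: eq_bigr => i nei /=.
  have := bad0 i nei; rewrite eqb0 -leqNgt => no_carry.
  have lt_i : ((u * H) %% p i ^ r i + h < p i ^ r i)%N.
    by apply: leq_trans no_carry; rewrite ltn_add2l.
  have E : (u * H + h = (u * H) %/ p i ^ r i * p i ^ r i + ((u * H) %% p i ^ r i + h))%N.
    by rewrite addnA -divn_eq.
  rewrite {1}E expr_e_fact_split //; congr (_ * w i ^+ e_fact _ _).
  by rewrite E modnMDl [RHS]modn_small.
- move=> x x1; apply: (@norm_sum_digits_le _ (m j)) => //; exact: ltW.
rewrite lerD2l ler_wpM2l ?ler0n // lerD2l ler_nat leq_mul2l exchange_big /=.
apply/orP; right; apply: leq_sum => i nei.
exact: count_carry_periods_le (dvdM i nei) _.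
Qed.

(** Divided by z L^t, the bound is (1 + P^k) N ((1 - 1/L)^t + (k+1)/z): digit saving, then carries
    (k/z) and last block (1/z). Clearing denominators leaves natural numbers on the right. *)
Lemma char_sum_numeric_le k (p m : 'I_k -> nat) (w : 'I_k -> algC) (j : 'I_k)
    (P mm t z N : nat) :
  let L := (4 * P * (P.+1 * mm) ^ 2)%N in
  injective p -> (forall i, prime (p i)) -> (forall i, 0 < m i)%N ->
  (forall i, p i <= P)%N -> (forall i, m i <= mm)%N ->
  (forall i, w i ^+ m i = 1) -> w j != 1 ->
  (0 < z)%N -> (P ^ t.*2 <= z)%N -> (z ^ (2 * k) <= N)%N ->
  (z * L ^ t)%:R * `|\sum_(n < N) \prod_i w i ^+ e_fact (p i) n| <=
    ((1 + P ^ k) * N * (z * L.-1 ^ t + k.+1 * L ^ t))%:R :> algC.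
Proof.
move=> L p_inj p_pr m_gt0 p_le m_le wm wj z_gt0 Pz zN.
have p_gt1 i : (1 < p i)%N by apply: prime_gt1.
have P_gt0 : (0 < P)%N by apply: leq_trans (p_le j); rewrite ltnW.
have mm_gt0 : (0 < mm)%N by apply: leq_trans (m_le j).
have L_gt1 : (1 < L)%N.
  rewrite /L -!mulnA (@leq_trans (4 * 1)) // leq_mul2l /=.
  by rewrite !(muln_gt0, expn_gt0) P_gt0 mm_gt0.
have L_gt0 : (0 < L)%N by apply: ltnW.
(* The least power of p_i above z^2, hence at most P z^2. *)
pose r i := (trunc_log (p i) (z ^ 2)).+1.
have z2_gt0 : (0 < z ^ 2)%N by rewrite expn_gt0 z_gt0.
have z2r i : (z ^ 2 < p i ^ r i)%N by apply: trunc_log_ltn.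
have rz2 i : (p i ^ r i <= P * z ^ 2)%N.
  by rewrite [leqLHS]expnS leq_mul // trunc_logP.
have pr_gt0 i : (0 < p i ^ r i)%N by rewrite expn_gt0 ltnW.
pose H := (p j ^ t.*2)%N; pose M := (\prod_(i < k | i != j) p i ^ r i)%N.
have H_gt0 : (0 < H)%N by rewrite expn_gt0 ltnW.
have M_gt0 : (0 < M)%N by apply: prodn_cond_gt0.
have Hz : (H <= z)%N.
  by apply: leq_trans Pz; rewrite /H; case: (t.*2) => // s; rewrite leq_exp2r.
have k_gt0 : (0 < k)%N by apply: leq_ltn_trans (ltn_ord j).
have z2N : (z ^ 2 <= N)%N by apply: leq_trans zN; rewrite leq_pexp2l // leq_pmulr.
(* The factor z^2 stands in for the missing p_j^(r_j), so that the product is at most (P z^2)^k. *)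
have Mz2 : (M * z ^ 2 <= P ^ k * N)%N.
  apply: (@leq_trans ((P * z ^ 2) ^ k)); last first.
    by rewrite expnMn -expnM leq_mul2l zN orbT.
  apply: (@leq_trans (\prod_i p i ^ r i)%N).
    by rewrite (bigD1 j) //= mulnC leq_mul // ltnW.
  have -> : ((P * z ^ 2) ^ k = \prod_(i < k) (P * z ^ 2))%N by rewrite prod_nat_const card_ord.
  by apply: leq_prod => i _.
have MH : (M * H <= P ^ k * N)%N.
  apply: leq_trans Mz2; rewrite leq_mul2l (leq_trans Hz) ?orbT //.
  by rewrite leq_pmulr.
pose T := (N %/ H %/ M).+1.
have TMH : (T * M * H <= (1 + P ^ k) * N)%N.
  rewrite /T mulSn mulnDl addnC mulnDl mul1n leq_add //.
  apply: leq_trans (leq_divM N H); rewrite leq_mul2r leq_divM orbT //.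
pose bad := (\sum_(i < k | i != j) M %/ p i ^ r i * H)%N.
(* Each summand satisfies z H <= z^2 < p_i^(r_i); the sum over i different from j is rounded up to k
   terms. *)
have zbad : (z * bad <= k * M)%N.
  rewrite big_distrr /= -[X in (_ <= X * _)%N]card_ord -sum_nat_const.
  rewrite [leqRHS](bigID (fun i => i != j)) /= -[leqLHS]addn0 leq_add //.
  apply: leq_sum => i nei; rewrite mulnCA.
  apply: leq_trans (leq_divM M (p i ^ r i)); rewrite leq_mul2l.
  by apply/orP; right; apply: leq_trans (ltnW (z2r i)); rewrite leq_mul2l Hz orbT.
pose lam : algC := L.-1%:R / L%:R.
have LR : 0 < L%:R :> algC by rewrite ltr0n.
have lamE : lam = 1 - L%:R^-1.
  by rewrite /lam -subn1 natrB // mulrBl mul1r divff // lt0r_neq0.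
have lam_gt0 : 0 < lam by rewrite divr_gt0 // ltr0n -subn1 subn_gt0.
have lam_ge : 1 - (4 * p j * ((p j).+1 * m j) ^ 2)%:R^-1 <= lam.
  have L0 : (0 < 4 * p j * ((p j).+1 * m j) ^ 2)%N.
    by rewrite !(muln_gt0, expn_gt0) m_gt0 (ltnW (p_gt1 j)).
  rewrite lamE lerD2l lerN2 lef_pV2 ?posrE ?ltr0n // ler_nat.
  apply: leq_mul; first by rewrite leq_mul2l p_le orbT.
  by rewrite leq_exp2r //; apply: leq_mul; [apply: p_le | apply: m_le].
have := @char_sum_le k p m w r j t N lam p_inj p_pr m_gt0 wm wj lam_gt0 lam_ge.
rewrite -/H -/M -/T -/bad => le_S.
apply: le_trans (ler_wpM2l (ler0n _ _) le_S) _.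
have lamt : L%:R ^+ t * lam ^+ t = L.-1%:R ^+ t by rewrite -exprMn mulrC divfK // lt0r_neq0.
clearbody lam T bad M H L.
have -> : (z * L ^ t)%:R * (H%:R + T%:R * (M%:R * (H%:R * lam ^+ t) + (H * bad)%:R))
    = (z * H * L ^ t + (T * M * H * (z * L.-1 ^ t) + T * H * (z * bad) * L ^ t))%:R :> algC.
  by rewrite !(natrM, natrD, natrX) -lamt; ring.
rewrite ler_nat.
have zH : (z * H <= N)%N by apply: leq_trans z2N; rewrite leq_mul2l Hz orbT.
have TH : (T * H * (z * bad) <= (1 + P ^ k) * N * k)%N.
  apply: (@leq_trans (T * H * (k * M))); first by rewrite leq_mul2l zbad orbT.
  have -> : (T * H * (k * M) = T * M * H * k)%N by ring.
  by rewrite leq_mul2r TMH orbT.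
have -> : ((1 + P ^ k) * N * (z * L.-1 ^ t + k.+1 * L ^ t)
  = (1 + P ^ k) * N * L ^ t
    + ((1 + P ^ k) * N * (z * L.-1 ^ t) + (1 + P ^ k) * N * k * L ^ t))%N.
  by ring.
by rewrite !leq_add ?leq_mul2r ?zH ?TMH ?TH ?orbT // (leq_trans zH) ?orbT // leq_pmull ?orbT.
Qed.

(** * Orthogonality and the count *)

Lemma unity_root_orthogonality (w : algC) m e a : m.-primitive_root w ->
  \sum_(h < m) (w ^+ e / w ^+ a) ^+ h = m%:R * (e == a %[mod m])%:R.
Proof.
move=> prim_w; have m_gt0 := prim_order_gt0 prim_w.
have w0 : w != 0 by rewrite -normr_eq0 (norm_unity m_gt0 (prim_expr_order prim_w)) oner_eq0.
have wa0 : w ^+ a != 0 by rewrite expf_neq0.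
rewrite -(eq_prim_root_expr prim_w) -subr_eq0 -(inj_eq (mulIf (invr_neq0 wa0))).
rewrite mul0r mulrBl divff //.
set x := w ^+ e / w ^+ a.
have xm : x ^+ m = 1.
  rewrite exprMn exprVn -!exprM ![(_ * m)%N]mulnC !exprM (prim_expr_order prim_w).
  by rewrite !expr1n divr1.
have [/eqP|x1] := eqVneq (x - 1) 0.
  rewrite subr_eq0 => /eqP->; under eq_bigr do rewrite expr1n.
  by rewrite sumr_const card_ord mulr1.
move: (subrX1 x m); rewrite xm subrr => /esym/eqP.
by rewrite mulf_eq0 (negPf x1) /= => /eqP->; rewrite mulr0.
Qed.

(** The product over i of the orthogonality relations is expanded into a sum over tuples of
    exponents. As the m_i differ, tuples are functions into one common ordinal, cut down by
    [family]. *)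
Lemma count_good_char_sums k (p m a : 'I_k -> nat) (w : 'I_k -> algC) N :
  (forall i, (m i).-primitive_root (w i)) ->
  (\prod_i m i * count_good p m a N)%:R =
  \sum_(f in family (fun i (h : 'I_(max_m m).+1) => (h < m i)%N))
    (\prod_i (w i ^- a i) ^+ f i) * \sum_(n < N) \prod_i (w i ^+ f i) ^+ e_fact (p i) n.
Proof.
move=> prim_w.
have m_le i : (m i <= (max_m m).+1)%N by rewrite ltnW // ltnS; apply: leq_bigmax.
have -> : count_good p m a N =
    (\sum_(n < N) [forall i, e_fact (p i) n == a i %[mod m i]])%N.
  by rewrite /count_good -sum1_count -big_mkcond /= -[N in LHS]subn0 big_mkord.
rewrite natrM natr_sum mulr_sumr.
under [RHS]eq_bigr => f _ do rewrite mulr_sumr.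
rewrite [RHS]exchange_big; apply: eq_bigr => n _ /=.
under [RHS]eq_bigr => f _.
  rewrite -big_split /=.
  under eq_bigr => i _ do rewrite exprAC -exprMn mulrC.
  over.
pose F i (h : 'I_(max_m m).+1) := (w i ^+ e_fact (p i) n / w i ^+ a i) ^+ h.
rewrite -(bigA_distr_big_dep _ F).
have -> : ([forall i, e_fact (p i) n == a i %[mod m i]])%:R
   = \prod_i (e_fact (p i) n == a i %[mod m i])%:R :> algC.
  case: (boolP [forall i, e_fact (p i) n == a i %[mod m i]]) => [/forallP h|/forallPn[i ni]].
    by rewrite big1 // => i _; rewrite h.
  by rewrite (bigD1 i) //= (negPf ni) mul0r.
rewrite natr_prod -big_split; apply: eq_bigr => i _ /=.
rewrite -(unity_root_orthogonality _ _ (prim_w i)).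
exact: (big_ord_widen _ (fun h => (w i ^+ e_fact (p i) n / w i ^+ a i) ^+ h) (m_le i)).
Qed.

Lemma card_family_lt k (m : 'I_k -> nat) b : (forall i, m i <= b)%N ->
  #|family (fun i (h : 'I_b) => (h < m i)%N)| = (\prod_i m i)%N.
Proof.
move=> m_le; rewrite card_family foldrE big_map big_enum; apply: eq_bigr => i _.
by rewrite -sum1_card -(big_ord_widen _ (fun=> 1%N) (m_le i)) sum1_card card_ord.
Qed.

(** The zero tuple contributes N, and fewer than Q others contribute at most Y / (z L^t) each. Two
    inequalities in [nat] form the bridge from [algC] to the real numbers. *)
Lemma count_good_nat_bound k (p m a : 'I_k -> nat) (P mm t z N : nat) :
  let L := (4 * P * (P.+1 * mm) ^ 2)%N in
  let Y := ((1 + P ^ k) * N * (z * L.-1 ^ t + k.+1 * L ^ t))%N in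
  let Q := (\prod_i m i)%N in
  injective p -> (forall i, prime (p i)) -> (forall i, 0 < m i)%N ->
  (forall i, p i <= P)%N -> (forall i, m i <= mm)%N ->
  (0 < z)%N -> (P ^ t.*2 <= z)%N -> (z ^ (2 * k) <= N)%N ->
  (Q * count_good p m a N * (z * L ^ t) <= N * (z * L ^ t) + Q * Y)%N /\
  (N * (z * L ^ t) <= Q * count_good p m a N * (z * L ^ t) + Q * Y)%N.
Proof.
move=> L Y Q p_inj p_pr m_gt0 p_le m_le z_gt0 Pz zN.
pose w i := sval (C_prim_root_exists (m_gt0 i)).
have prim_w i : (m i).-primitive_root (w i) := svalP (C_prim_root_exists (m_gt0 i)).
have w1 i : `|w i| = 1 := norm_unity (m_gt0 i) (prim_expr_order (prim_w i)).
have m_le' i : (m i <= (max_m m).+1)%N by rewrite ltnW // ltnS; apply: leq_bigmax.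
set X := (z * L ^ t)%N.
pose S (f : {ffun 'I_k -> 'I_(max_m m).+1}) :=
  (\prod_i (w i ^- a i) ^+ f i) * \sum_(n < N) \prod_i (w i ^+ f i) ^+ e_fact (p i) n.
pose fam := family (fun i (h : 'I_(max_m m).+1) => (h < m i)%N).
pose f0 : {ffun 'I_k -> 'I_(max_m m).+1} := [ffun=> ord0].
have fam0 : f0 \in fam by apply/familyP => i; rewrite ffunE unfold_in; apply: m_gt0.
have S0 : S f0 = N%:R.
  rewrite /S big1 ?mul1r => [|i _]; last by rewrite ffunE expr0.
  rewrite -[RHS]mulr1 mulr_natl -[X in _ *+ X]card_ord -sumr_const; apply: eq_bigr => n _.
  by rewrite big1 // => i _; rewrite ffunE expr0 expr1n.
have SY f : f \in fam -> f != f0 -> X%:R * `|S f| <= Y%:R.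
  move=> /familyP famf nef.
  have [j fj] : exists j, f j != ord0.
    apply/existsP; apply: contraNT nef; rewrite negb_exists => /forallP f_0.
    by apply/eqP/ffunP => i; rewrite ffunE; apply/eqP; rewrite -[_ == _]negbK f_0.
  rewrite normrM normr_prod big1 ?mul1r => [|i _]; last first.
    by rewrite normrX normfV normrX w1 expr1n invr1 expr1n.
  apply: (char_sum_numeric_le (m := m) (j := j)) => // [i|].
    by rewrite exprAC (prim_expr_order (prim_w i)) expr1n.
  (* As 0 < f_j < m_j and w_j is primitive, w_j^(f_j) is not 1. *)
  rewrite -(expr0 (w j)) (eq_prim_root_expr (prim_w j)) mod0n modn_small //.
  exact: famf.
have key : X%:R * `|(Q * count_good p m a N)%:R - N%:R| <= (Q * Y)%:R :> algC.
  rewrite (count_good_char_sums _ _ _ prim_w) -/fam -/S (bigD1 f0) //= -/(S f0) S0.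
  rewrite addrAC subrr add0r.
  apply: le_trans (ler_wpM2l (ler0n _ _) (ler_norm_sum _ _ _)) _.
  rewrite mulr_sumr natrM mulr_natl /Q -(card_family_lt m_le') -sumr_const.
  rewrite [leRHS](bigD1 f0) //= -[leLHS]add0r lerD ?ler0n //.
  by apply: ler_sum => f /andP[]; apply: SY.
have natP (u v : nat) : X%:R * `|u%:R - v%:R| <= (Q * Y)%:R :> algC ->
    (u * X <= v * X + Q * Y)%N.
  move=> le; rewrite -(ler_nat algC) natrD (natrM _ u X) (natrM _ v X) -lerBlDl -mulrBl mulrC.
  apply: le_trans le; rewrite ler_wpM2l ?ler0n // real_ler_norm //.
  by rewrite rpredB ?realn.
by split; apply: natP => //; rewrite distrC.
Qed.

Local Close Scope ring_scope.

(** * Choice of z and size of the exponent *)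

Lemma nat_root d N : 0 < d -> 0 < N -> exists2 z, 0 < z & z ^ d <= N < z.+1 ^ d.
Proof.
move=> d_gt0; elim: N => // -[_ _|N IHN _].
  by exists 1; rewrite // exp1n leqnn /=; have := ltn_exp2r 1 2 d_gt0; rewrite exp1n => ->.
have [//|z z_gt0 /andP[zN Nz]] := IHN.
have [lez|ltz] := leqP (z.+1 ^ d) N.+2.
  by exists z.+1; rewrite // lez (leq_ltn_trans Nz) // ltn_exp2r.
by exists z; rewrite // ltz leqW.
Qed.

(** The left side is 4 k P L, whose inverse is an exponent that the decay estimate allows; the right
    side is 1 / [delta]. The proof only needs 64 in place of 120 and P^4 in place of P^(3m). *)
Lemma exponent_numeric k P mm : 0 < k -> 1 < P -> 1 < mm ->
  4 * k * P * (4 * P * (P.+1 * mm) ^ 2) <= 120 * k ^ 2 * P ^ (3 * mm) * mm ^ 2.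
Proof.
move=> k_gt0 P_gt1 mm_gt1; have P_gt0 := ltnW P_gt1.
have le1 : P.+1 ^ 2 <= 4 * P ^ 2.
  by rewrite -[4]/(2 ^ 2) -expnMn leq_exp2r // mul2n -addnn -addn1 leq_add2l.
have le2 : P ^ 4 <= P ^ (3 * mm).
  by rewrite leq_pexp2l // (@leq_trans (3 * 2)) // leq_mul2l.
have -> : 4 * k * P * (4 * P * (P.+1 * mm) ^ 2) = 16 * k * P ^ 2 * P.+1 ^ 2 * mm ^ 2.
  by rewrite expnMn; ring.
rewrite leq_mul2r; apply/orP; right.
apply: (@leq_trans (16 * k * P ^ 2 * (4 * P ^ 2))); first by rewrite leq_mul2l le1 orbT.
have -> : 16 * k * P ^ 2 * (4 * P ^ 2) = 64 * k * P ^ 4 by ring.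
by rewrite leq_mul // leq_mul // leq_pmulr.
Qed.

(* Importing [Reals] makes [^] on [nat] denote [Nat.pow], as in [delta]; the
   power of [ssrnat] is written [expn] from here on. *)
From Stdlib Require Import Reals Lra.

(** * Decay estimates over the reals *)

Lemma expn_pow (a b : nat) : expn a b = Nat.pow a b.
Proof. by elim: b => //= b <-; rewrite expnS. Qed.

Local Open Scope R_scope.

Lemma INR_expn (a b : nat) : INR (expn a b) = INR a ^ b.
Proof. by rewrite expn_pow pow_INR. Qed.

Lemma INR_muln (a b : nat) : INR (muln a b) = INR a * INR b.
Proof. exact: mult_INR. Qed.

Lemma INR_addn (a b : nat) : INR (addn a b) = INR a + INR b.
Proof. exact: plus_INR. Qed.

Lemma INR_leq (a b : nat) : leq a b -> INR a <= INR b.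
Proof. by move/ssrnat.leP; exact: le_INR. Qed.

Lemma ln_le x y : 0 < x -> x <= y -> ln x <= ln y.
Proof. by move=> x0 [xy|->]; [exact/Rlt_le/ln_increasing | exact: Rle_refl]. Qed.

Lemma exp_le x y : x <= y -> exp x <= exp y.
Proof. by case=> [xy|->]; [exact/Rlt_le/exp_increasing | exact: Rle_refl]. Qed.

Lemma ln_le_self x : 0 < x -> ln x <= x.
Proof.
move=> x0; rewrite -[X in _ <= X]ln_exp; apply: ln_le => //.
by have := exp_ineq1_le x; lra.
Qed.

(* Here [z] is the integral part of [N^(1/2k)] and [P^(2t)] is within a factor
   [P^2] of [z]. *)
Section Decay.

Variables (N z k : nat) (d : R).
Hypotheses (N_gt0 : leq 1 N) (z_gt0 : leq 1 z) (k_gt0 : leq 1 k) (d_ge0 : 0 <= d).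
Hypothesis Nz : leq (S N) (expn (S z) (muln 2 k)).

Let z1 : 1 <= INR z. Proof. by have := INR_leq z_gt0. Qed.
Let k1 : 1 <= INR k. Proof. by have := INR_leq k_gt0. Qed.
Let N1 : 1 <= INR N. Proof. by have := INR_leq N_gt0. Qed.

Lemma ln_root_le : ln (INR N) <= 2 * INR k * ln (2 * INR z).
Proof.
have z0 : 0 < 2 * INR z by lra.
have -> : 2 * INR k * ln (2 * INR z) = ln ((2 * INR z) ^ (muln 2 k)).
  by rewrite ln_pow // INR_muln.
apply: ln_le; first lra.
have /INR_leq : leq N (expn (S z) (muln 2 k)) by apply: ltnW.
rewrite INR_expn S_INR => /Rle_trans; apply; apply: pow_incr; lra.
Qed.

(** This treats the terms in 1/z: N < (z+1)^(2k) <= (2z)^(2k) gives N^d <= 2z as soon as 2kd <=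
    1. *)
Lemma inv_root_le : d * (2 * INR k) <= 1 -> / INR z <= 2 * Rpower (INR N) (- d).
Proof.
move=> dk; have z0 : 0 < 2 * INR z by lra.
suff : / (2 * INR z) <= Rpower (INR N) (- d).
  by rewrite Rinv_mult => h; lra.
rewrite -[X in / X]exp_ln // -exp_Ropp /Rpower.
have ln0 : 0 <= ln (2 * INR z) by rewrite -ln_1; apply: ln_le; lra.
have lnN := ln_root_le.
have le1 : d * ln (INR N) <= ln (2 * INR z).
  have := Rmult_le_compat_l _ _ _ d_ge0 lnN.
  have := Rmult_le_compat_r _ _ _ ln0 dk; lra.
apply: exp_le; lra.
Qed.

Variables (P t : nat) (L : R).
Hypotheses (P_gt1 : leq 2 P) (zP : leq (S z) (expn P (S (S t.*2)))) (L_ge1 : 1 <= L).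

(** By 1 - 1/L <= exp(-1/L) it suffices that d ln N <= 2 + t/L. Now 2z <= P^(2t+3) and ln P <= P
    give d ln N <= 2kd (2t+3) P = (4kPLd) (t + 3/2) / L, and 3/(2L) is rounded up to 2. *)
Lemma geometric_decay_le : 4 * INR k * INR P * L * d <= 1 ->
  (1 - / L) ^ t <= exp 2 * Rpower (INR N) (- d).
Proof.
move=> dL; have P2 : 2 <= INR P by have := INR_leq P_gt1.
have L0 : 0 < / L by apply: Rinv_0_lt_compat; lra.
have LV : L * / L = 1 by apply: Rinv_r; lra.
have t0 := pos_INR t.
have lnz : ln (2 * INR z) <= (2 * INR t + 3) * INR P.
  apply: (Rle_trans _ (ln (INR P ^ (S (S (S t.*2)))))).
    apply: ln_le; first lra.
    have /INR_leq : leq z (expn P (S (S t.*2))) by apply: ltnW.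
    rewrite INR_expn => le /=; apply: Rmult_le_compat; rewrite ?Rmult_1_l //; lra.
  rewrite ln_pow; last lra.
  rewrite !S_INR -mul2n INR_muln /=.
  have lnP : ln (INR P) <= INR P by apply: ln_le_self; lra.
  have t3 : 0 <= 2 * INR t + 3 by lra.
  by have := Rmult_le_compat_l _ _ _ t3 lnP; lra.
have lnN := ln_root_le.
have le1 : d * ln (INR N) <= 2 + INR t * / L.
  have s1 : d * ln (INR N) <= d * (2 * INR k * ((2 * INR t + 3) * INR P)).
    apply: Rmult_le_compat_l => //; apply: Rle_trans lnN _.
    by apply: Rmult_le_compat_l => //; lra.
  have s2 : (4 * INR k * INR P * L * d) * (/ L * (INR t + 3 / 2))
      <= 1 * (/ L * (INR t + 3 / 2)).
    by apply: Rmult_le_compat_r => //; apply: Rmult_le_pos; lra.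
  have s3 : (4 * INR k * INR P * L * d) * (/ L * (INR t + 3 / 2))
    = (d * (2 * INR k * ((2 * INR t + 3) * INR P))) * (L * / L) by field; lra.
  have L1 : / L <= 1 by rewrite -Rinv_1; apply: Rinv_le_contravar; lra.
  by rewrite s3 LV in s2; lra.
apply: (Rle_trans _ (exp (- / L) ^ t)).
  apply: pow_incr; split; last by have := exp_ineq1_le (- / L); lra.
  have : / L <= 1 by rewrite -Rinv_1; apply: Rinv_le_contravar; lra.
  lra.
have -> : exp (- / L) ^ t = exp (- (INR t * / L)).
  by rewrite -Rpower_pow ?/Rpower ?ln_exp; [congr exp; ring | exact: exp_pos].
rewrite /Rpower -exp_plus.
apply: exp_le; lra.
Qed.

End Decay.

Local Close Scope R_scope.

(** * The asymptotic formula *)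

Lemma delta_bounds k (p m : 'I_k -> nat) : (0 < k)%N -> (1 < max_p p)%N -> (1 < max_m m)%N ->
  (0 < delta p m /\ 4 * INR k * INR (max_p p)
     * INR (4 * max_p p * expn ((max_p p).+1 * max_m m) 2) * delta p m <= 1)%R.
Proof.
move=> k_gt0 P_gt1 m_gt1; have := INR_leq (exponent_numeric k_gt0 P_gt1 m_gt1).
set L := (4 * max_p p * _)%N; rewrite /delta !expn_pow.
set D := INR (120 * _ * _ * _)%N; rewrite 3!INR_muln.
have -> : INR 4 = 4%R by rewrite /=; ring.
have k1 := INR_leq k_gt0; have P1 := INR_leq P_gt1.
have L1 : (1 <= INR L)%R.
  apply: (@INR_leq 1); rewrite /L !(muln_gt0, expn_gt0) (ltnW P_gt1) (ltnW m_gt1) //.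
move: k1 P1; rewrite /= => k1 P1 le.
have D0 : (0 < D)%R.
  apply: Rlt_le_trans le; repeat apply: Rmult_lt_0_compat; lra.
split; first by apply: Rdiv_lt_0_compat; lra.
by rewrite /Rdiv Rmult_1_l; apply: (Rmult_le_reg_r D) => //; rewrite Rmult_assoc Rinv_l; lra.
Qed.

Lemma count_good_asymptotic k (p m : 'I_k -> nat) :
  (0 < k)%N -> injective p -> (forall i, prime (p i)) -> (forall i, (2 <= m i)%N) ->
  exists C : R, forall a : 'I_k -> nat, forall N : nat, (1 <= INR N)%R ->
    (Rabs (INR (count_good p m a N) - INR N / INR (\prod_(i < k) m i))
       <= C * Rpower (INR N) (1 - delta p m))%R.
Proof.
move=> k_gt0 p_inj p_pr m_ge2.
set P := max_p p; set mm := max_m m; set d := delta p m.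
have p_le i : (p i <= P)%N by apply: leq_bigmax.
have m_le i : (m i <= mm)%N by apply: leq_bigmax.
have m_gt0 i : (0 < m i)%N by apply: ltnW.
pose i0 := Ordinal k_gt0.
have P_gt1 : (1 < P)%N by apply: leq_trans (p_le i0); apply: prime_gt1.
have mm_gt1 : (1 < mm)%N by apply: leq_trans (m_le i0).
set L := (4 * P * expn (P.+1 * mm) 2)%N.
have [d_gt0 dL] : (0 < d /\ 4 * INR k * INR P * INR L * d <= 1)%R by apply: delta_bounds.
have L_gt0 : (0 < L)%N by rewrite /L !(muln_gt0, expn_gt0) (ltnW P_gt1) (ltnW mm_gt1).
(* [exp 2] comes from [geometric_decay_le], and 2 (k+1) from the k + 1 terms 1/z with
   [inv_root_le]. *)
exists ((1 + INR P ^ k) * (exp 2 + 2 * (INR k + 1)))%R => a N N1.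
have N_gt0 : (0 < N)%N by case: N N1 => // /=; lra.
have k2_gt0 : (0 < 2 * k)%N by rewrite muln_gt0.
have [z z_gt0 /andP[zN Nz]] := nat_root k2_gt0 N_gt0.
have P2_gt1 : (1 < P * P)%N by rewrite (leq_trans P_gt1) // leq_pmulr // ltnW.
(* The largest t with P^(2t) <= z, so that z < P^(2t+2). *)
pose t := trunc_log (P * P) z.
have PPt s : expn (P * P) s = expn P s.*2 by rewrite mulnn -expnM mul2n.
have Pz : (expn P t.*2 <= z)%N by rewrite -PPt trunc_logP.
have zP : (z < expn P t.*2.+2)%N by rewrite -doubleS -PPt trunc_log_ltn.
have [le1 le2] := count_good_nat_bound a p_inj p_pr m_gt0 p_le m_le z_gt0 Pz zN.
move: le1 le2 => /INR_leq le1 /INR_leq le2; move: le1 le2; rewrite -/L.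
clearbody L t.
rewrite !(INR_muln, INR_addn, INR_expn).
set c := INR (count_good p m a N); set Q := INR (\prod_(i < k) m i).
have Q0 : (0 < Q)%R by apply: lt_0_INR; apply/ssrnat.ltP; apply: prodn_gt0.
have L1 : (1 <= INR L)%R := INR_leq L_gt0.
have z1 : (1 <= INR z)%R := INR_leq z_gt0.
have k1 : (1 <= INR k)%R := INR_leq k_gt0.
have P2 : (2 <= INR P)%R by have := INR_leq P_gt1; rewrite /=; lra.
have -> : INR L.-1 = (INR L * (1 - / INR L))%R.
  by rewrite -[in RHS](prednK L_gt0) S_INR; field; have := pos_INR L.-1; lra.
rewrite Rpow_mult_distr (S_INR k).
have Lt0 : (0 < INR L ^ t)%R by apply: pow_lt; lra.
have Pk0 : (0 < INR P ^ k)%R by apply: pow_lt; lra.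
have dk : (d * (2 * INR k) <= 1)%R.
  have h : (1 * 2 <= INR L * INR P)%R by apply: Rmult_le_compat; lra.
  have h2 : (0 <= INR k * d)%R by apply: Rmult_le_pos; lra.
  have := Rmult_le_compat_l _ _ _ h2 h; lra.
have decay1 := inv_root_le N_gt0 z_gt0 (Rlt_le _ _ d_gt0) Nz dk.
have decay2 := geometric_decay_le N_gt0 z_gt0 k_gt0 (Rlt_le _ _ d_gt0) Nz P_gt1 zP L1 dL.
set rho := Rpower (INR N) (- d) in decay1 decay2.
set lamt := ((1 - / INR L) ^ t)%R in decay2 *.
have -> : Rpower (INR N) (1 - d) = (INR N * rho)%R.
  by rewrite /Rminus Rpower_plus Rpower_1 //; lra.
(* The error bound for one character sum, freed of its denominator X = z L^t. *)
set W := ((1 + INR P ^ k) * INR N * (lamt + (INR k + 1) * / INR z))%R.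
have leW : (W <= (1 + INR P ^ k) * (exp 2 + 2 * (INR k + 1)) * (INR N * rho))%R.
  have -> : ((1 + INR P ^ k) * (exp 2 + 2 * (INR k + 1)) * (INR N * rho)
     = (1 + INR P ^ k) * INR N * (exp 2 * rho + (INR k + 1) * (2 * rho)))%R by ring.
  apply: Rmult_le_compat_l; first by apply: Rmult_le_pos; lra.
  by apply: Rplus_le_compat => //; apply: Rmult_le_compat_l => //; lra.
set X := (INR z * INR L ^ t)%R.
have X0 : (0 < X)%R by apply: Rmult_lt_0_compat; lra.
have -> : (INR 1 = 1)%R by [].
have -> : ((1 + INR P ^ k) * INR N
    * (INR z * (INR L ^ t * lamt) + (INR k + 1) * INR L ^ t) = W * X)%R.
  by rewrite /W /X; field; lra.
move=> le1 le2.
have {}le1 : (Q * c <= INR N + Q * W)%R by apply: (Rmult_le_reg_r X) => //; lra.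
have {}le2 : (INR N <= Q * c + Q * W)%R by apply: (Rmult_le_reg_r X) => //; lra.
have E : (INR N = Q * (INR N / Q))%R by field; lra.
apply: Rle_trans leW; apply: Rabs_le; split; apply: (Rmult_le_reg_l Q) => //; lra.
Qed.

Lemma Rpower_neg_cv0 (d : R) : (0 < d)%R -> Un_cv (fun N => Rpower (INR N) (- d)) 0%R.
Proof.
move=> d0 e e0.
have [n0 Hn0] := INR_unbounded (Rpower e (- / d)).
exists n0.+1 => n /ssrnat.leP n_ge; rewrite /R_dist Rminus_0_r Rabs_pos_eq; last exact/Rlt_le/exp_pos.
have lt : (Rpower e (- / d) < INR n)%R.
  by apply: Rlt_le_trans Hn0 _; apply: INR_leq; apply: ltnW.
have E0 : (0 < Rpower e (- / d))%R by apply: exp_pos.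
have -> : e = Rpower (Rpower e (- / d)) (- d).
  rewrite Rpower_mult; have -> : (- / d * - d = 1)%R by field; lra.
  by rewrite Rpower_1.
apply: exp_increasing.
by have := Rmult_lt_compat_l d _ _ d0 (ln_increasing _ _ E0 lt); lra.
Qed.

Theorem theorem1 :
  (forall (k : nat) (p m : 'I_k -> nat),
      (0 < k)%N ->
      injective p ->
      (forall i, prime (p i)) ->
      (forall i, (2 <= m i)%N) ->
      (forall i, ~~ (p i %| m i)%N) ->
      exists C N0 : R,
        forall a : 'I_k -> nat, (forall i, (a i < m i)%N) ->
        forall N : nat, (N0 <= INR N)%R ->
          (Rabs (INR (count_good p m a N) - INR N / INR (\prod_(i < k) m i))
             <= C * Rpower (INR N) (1 - delta p m))%R)
  /\
  (forall (k : nat) (p : 'I_k -> nat) (eps : 'I_k -> bool),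
      (0 < k)%N ->
      injective p ->
      (forall i, prime (p i)) ->
      (forall i, odd (p i)) ->
      Un_cv (fun N : nat =>
               (INR (count_good p (fun _ => S (S O)) (fun i => nat_of_bool (eps i)) N)
                / (INR N / 2 ^ k))%R) 1%R).
Proof.
split=> [k p m k_gt0 p_inj p_pr m_ge2 _|k p eps k_gt0 p_inj p_pr _].
  have [C HC] := count_good_asymptotic k_gt0 p_inj p_pr m_ge2.
  by exists C, 1%R => a _ N; apply: HC.
pose m (_ : 'I_k) := 2.
have [C HC] := @count_good_asymptotic k p m k_gt0 p_inj p_pr (fun=> leqnn 2).
have d_gt0 : (0 < delta p m)%R.
  have i0 := Ordinal k_gt0.
  have [] // := @delta_bounds k p m k_gt0; last by apply: (@leq_bigmax _ m i0).
  by apply: leq_trans (leq_bigmax i0); apply: prime_gt1.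
have two_k : (INR (\prod_(i < k) m i) = 2 ^ k)%R.
  by rewrite prod_nat_const card_ord INR_expn /=; congr (_ ^ _)%R; ring.
have k0 : (0 < 2 ^ k)%R by apply: pow_lt; lra.
move=> e e0.
(* The error of the ratio is at most C 2^k N^(-delta); [Rabs] and the added 1 keep the divisor of e
   positive whatever the sign of C. *)
have C0 : (0 < Rabs C * 2 ^ k + 1)%R.
  by have := Rmult_le_pos _ _ (Rabs_pos C) (Rlt_le _ _ k0); lra.
have [n0 Hn0] := Rpower_neg_cv0 d_gt0 (Rdiv_lt_0_compat _ _ e0 C0).
exists n0.+1 => N /ssrnat.leP N_ge.
have N1 : (1 <= INR N)%R by apply: (@INR_leq 1); apply: leq_trans N_ge.
have := Hn0 N (ssrnat.leP (ltnW N_ge)).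
have := HC (fun i => nat_of_bool (eps i)) N N1.
rewrite two_k /R_dist Rminus_0_r.
set c := INR _; set d := delta p m.
have r0 : (0 < Rpower (INR N) (- d))%R by apply: exp_pos.
rewrite (Rabs_pos_eq (Rpower _ _)); last exact: Rlt_le.
have -> : Rpower (INR N) (1 - d) = (INR N * Rpower (INR N) (- d))%R.
  by rewrite /Rminus Rpower_plus Rpower_1 //; lra.
set rho := Rpower _ _ in r0 *; move=> le lt.
have -> : (c / (INR N / 2 ^ k) - 1 = (c - INR N / 2 ^ k) * (2 ^ k / INR N))%R by field; lra.
have q0 : (0 < 2 ^ k / INR N)%R by apply: Rdiv_lt_0_compat; lra.
rewrite Rabs_mult (Rabs_pos_eq (2 ^ k / INR N)%R); last exact: Rlt_le.
apply: Rle_lt_trans (Rmult_le_compat_r _ _ _ (Rlt_le _ _ q0) le) _.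
have -> : (C * (INR N * rho) * (2 ^ k / INR N) = C * 2 ^ k * rho)%R by field; lra.
have {}lt : (rho * (Rabs C * 2 ^ k + 1) < e)%R.
  have := Rmult_lt_compat_r _ _ _ C0 lt.
  by have -> : (e / (Rabs C * 2 ^ k + 1) * (Rabs C * 2 ^ k + 1) = e)%R by field; lra.
have h : (C * (2 ^ k * rho) <= Rabs C * (2 ^ k * rho))%R.
  apply: Rmult_le_compat_r; last exact: Rle_abs.
  by apply: Rmult_le_pos; lra.
lra.
Qed.
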